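(* Let $N$ be a square-free positive integer that is not a perfect square, with continued fraction expansion $\sqrt N=[a_0;\overline{a_1,a_2,\ldots,a_{\tau-1},2a_0}]$ of (minimal) period length $\tau$. For $j\ge0$ define $$d_j=\frac12\ln\left(\frac{\sqrt N+(-1)^j\Omega_j}{\sqrt N-(-1)^j\Omega_j}\right).$$ Then $$\sum_{j=0}^{\tau-1}d_j=\ln\left(A_{\tau-1}+B_{\tau-1}\sqrt N\right),$$ and consequently this quantity equals either $R_{\mathbb F}$ or $3R_{\mathbb F}$, where $R_{\mathbb F}$ is the regulator of $\mathbb F=\mathbb Q(\sqrt N)$, i.e. the logarithm of the fundamental unit $\epsilon_0>1$ of the ring of integers of $\mathbb F$.
   Context: $a_0=\lfloor\sqrt N\rfloor$ and $(a_m)_{m\ge 0}$ are the partial quotients of $\sqrt N$. The convergents are defined by $A_{-1}=1$, $B_{-1}=0$, $A_0=a_0$, $B_0=1$, and for $m\ge1$: $A_m=a_mA_{m-1}+A_{m-2}$, $B_m=a_mB_{m-1}+B_{m-2}$. For $m\ge0$, $\Omega_m=A_mA_{m-1}-NB_mB_{m-1}$ (so $\Omega_0=a_0$). The paper calls $\sum_{j=0}^{\tau-1}d_j$ the distance $d(\mathbf f_\tau,\mathbf f_0)$ between quadratic forms in its sequence of forms. *)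

(* Defs.v *)
From HB Require Import structures.
From mathcomp Require Import all_boot all_order all_algebra.
From mathcomp Require Import all_classical all_reals all_analysis.

Set Implicit Arguments.
Unset Strict Implicit.
Unset Printing Implicit Defensive.

Import Order.TTheory GRing.Theory Num.Theory.

Local Open Scope classical_set_scope.
Local Open Scope ring_scope.

Definition squarefree (N : nat) : Prop :=
  forall d : nat, (d ^ 2 %| N)%N -> d = 1%N.

Section ContinuedFraction.
Variable R : realType.

Fixpoint complete_quotient (x : R) (m : nat) : R :=
  if m is m'.+1 then
    (complete_quotient x m' - (Num.floor (complete_quotient x m'))%:~R)^-1
  else x.

Definition partial_quotient (x : R) (m : nat) : int :=
  Num.floor (complete_quotient x m).

End ContinuedFraction.

(* Indices are shifted by one, because the recurrences start at index -1:
   [conv_num a n] is A_(n-1) and [conv_den a n] is B_(n-1). *)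
Fixpoint conv_num (a : nat -> int) (n : nat) : int :=
  match n with
  | 0 => 1
  | n1.+1 => match n1 with
             | 0 => a 0%N
             | n2.+1 => a n1 * conv_num a n1 + conv_num a n2
             end
  end.

Fixpoint conv_den (a : nat -> int) (n : nat) : int :=
  match n with
  | 0 => 0
  | n1.+1 => match n1 with
             | 0 => 1
             | n2.+1 => a n1 * conv_den a n1 + conv_den a n2
             end
  end.

(* The period of [a_0; a_1, a_2, ...] starts at a_1. *)
Definition is_period (a : nat -> int) (t : nat) : Prop :=
  (0 < t)%N /\ forall m : nat, (0 < m)%N -> a (m + t)%N = a m.

Definition is_minimal_period (a : nat -> int) (t : nat) : Prop :=
  is_period a t /\ forall s : nat, is_period a s -> (t <= s)%N.

Section SqrtN.
Variables (R : realType) (N : nat).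

Definition sqrtN : R := Num.sqrt N%:R.

Definition a_ (m : nat) : int := partial_quotient sqrtN m.

(* Omega_m = A_m A_(m-1) - N B_m B_(m-1) *)
Definition Omega (m : nat) : int :=
  conv_num a_ m.+1 * conv_num a_ m
  - N%:Z * (conv_den a_ m.+1 * conv_den a_ m).

Definition d_ (j : nat) : R :=
  2^-1 * ln ((sqrtN + (-1) ^+ j * (Omega j)%:~R)
             / (sqrtN - (-1) ^+ j * (Omega j)%:~R)).

(* The field Q(sqrt N), as a subset of the reals. *)
Definition quadratic_field : set R :=
  [set x | exists p q : rat, x = ratr p + ratr q * sqrtN].

Definition ring_of_integers : set R :=
  [set x | quadratic_field x /\ integralOver (intr : int -> R) x].

Definition integer_units : set R :=
  [set u | ring_of_integers u /\ exists2 v, ring_of_integers v & u * v = 1].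

Definition is_fundamental_unit (e : R) : Prop :=
  [/\ integer_units e, 1 < e &
      forall u, integer_units u -> exists k : int, u = e ^ k \/ u = - e ^ k].

(* The default value 1 is taken only if there is no fundamental unit. *)
Definition fundamental_unit : R := xget 1 [set e | is_fundamental_unit e].

Definition regulator : R := ln fundamental_unit.

End SqrtN.

(* Main.v *)
(* Write s = sqrt N, beta_n = A_(n-1) + B_(n-1) s and alpha_n for its conjugate,
   so that the complete quotients are -alpha_n / alpha_(n+1) and the alpha_n
   alternate in sign. The argument of the logarithm in d_j is
   -(alpha_j beta_(j+1)) / (alpha_(j+1) beta_j), so the sum telescopes to half
   the logarithm of beta_tau / |alpha_tau|, which is beta_tau^2 because
   beta_tau has norm (-1)^tau: equal partial quotients force equal complete
   quotients, so the complete quotient of index tau is a_0 + s.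

   A unit u > 1 of Z[s] is some beta_n: if beta_n < u < beta_(n+1), then
   expanding u in the basis beta_n, beta_(n+1) contradicts |u u'| = 1. Norm
   +-1 at n makes n a period, so beta_tau is the least unit > 1 of Z[s].
   Finally, a unit e of the ring of integers is (a + b s)/2 with
   a^2 - N b^2 = +-4, and a parity argument puts e or e^3 in Z[s]; hence
   beta_tau is the fundamental unit or its cube. *)

Require Import Defs.
From mathcomp Require Import all_boot all_order all_algebra.
From mathcomp Require Import all_classical all_reals all_analysis.
From mathcomp Require Import ring lra zify.

Import Order.TTheory GRing.Theory Num.Theory.

Local Open Scope ring_scope.

(** * Integrality criteria for rational numbers *)

Lemma intz_mul_eq1 (x y : int) : x * y = 1 -> x = 1 \/ x = -1.
Proof.
move=> xy1; have: (`|x| * `|y|)%N = 1%N by rewrite -abszM xy1.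
by move/eqP; rewrite muln_eq1 => /andP[/eqP h _]; lia.
Qed.

(** For y = a/b in lowest terms, b^2 divides N a^2 and is coprime to a^2; so b^2 divides N, which
    forces b = 1. *)
Lemma rat_int_of_sqr (N : nat) (y : rat) (m : int) :
  squarefree N -> N%:R * y ^+ 2 = m%:~R -> exists k : int, y = k%:~R.
Proof.
move=> sqfN; set a := numq y; set b := denq y.
have b0 : b%:~R != 0 :> rat by rewrite intr_eq0 denq_neq0.
have yE : y = a%:~R / b%:~R by rewrite divq_num_den.
move=> yN; have: (N%:Z * a ^+ 2)%:~R = (m * b ^+ 2)%:~R :> rat.
  rewrite !(rmorphXn, rmorphM) /= -yN [in RHS]yE.
  by field.
move/intr_inj/(congr1 absz); rewrite !(abszX, abszM) absz_nat => abE.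
have: (`|b| ^ 2 %| N * `|a| ^ 2)%N by rewrite abE dvdn_mull.
rewrite Gauss_dvdl; last first.
  by rewrite coprimeXl // coprimeXr // coprime_sym coprime_num_den.
move/sqfN => b1; exists a.
have b1' : b = 1 by have := denq_gt0 y; rewrite -/b; lia.
by rewrite yE b1' divr1.
Qed.

Lemma squarefree1 : squarefree 1.
Proof. by move=> d; rewrite dvdn1 expnS expn1 muln_eq1 andbb => /eqP. Qed.

(** Gauss's lemma: X - r divides a monic integer polynomial over the rationals, so some scalar
    multiple [p1] of it divides that polynomial over the integers. The leading coefficients multiply
    to 1, hence [p1] is X - r up to sign. *)
Lemma integral_rat_int (R : realType) (r : rat) :
  integralOver (intr : int -> R) (ratr r) -> exists k : int, r = k%:~R.
Proof.
move=> [p mon_p].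
have -> : map_poly intr p = map_poly (ratr : rat -> R) (map_poly intr p).
  by rewrite -map_poly_comp; apply: eq_map_poly => z /=; rewrite ratr_int.
rewrite fmorph_root -dvdp_XsubCl => /dvdpP_rat_int [p1 [c c0 XE] [t pE]].
have sz : size p1 = 2%N.
  have := size_XsubC r; rewrite XE size_scale // size_map_inj_poly //.
  exact: intr_inj.
have lp : lead_coef p1 * lead_coef t = 1.
  by rewrite -lead_coefM -pE; apply/eqP.
have E1 := congr1 (fun q : {poly rat} => q`_1) XE.
have E0 := congr1 (fun q : {poly rat} => q`_0) XE.
rewrite !(coefE, coef_map_id0) ?sz //= in E1 E0.
case/intz_mul_eq1: lp; rewrite lead_coefE sz /= => p11; rewrite p11 in E1.
  have c1 : c = 1 by lra.
  by exists (- p1`_0); move: E0; rewrite c1 rmorphN /=; lra.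
have c1 : c = -1 by lra.
by exists p1`_0; move: E0; rewrite c1; lra.
Qed.

(** * Integers and units of Q(sqrt N) *)

Section QuadraticOrder.
Variables (R : realType) (N : nat).
Hypothesis N_squarefree : squarefree N.
Hypothesis N_nonsquare : forall k : nat, N <> (k ^ 2)%N.

Local Notation s := (sqrtN R N).

Lemma sqr_sqrtN : s ^+ 2 = N%:R.
Proof. by rewrite sqr_sqrtr. Qed.

Lemma sqrtN_gt1 : 1 < s.
Proof.
rewrite -[X in X < _]sqrtr1 ltr_sqrt ?ltr1n ?ltr0n //; have := N_nonsquare 1.
all: by have := N_nonsquare 0; rewrite ?exp1n ?exp0n //; lia.
Qed.

Lemma sqrtN_irrational (p q : rat) :
  ratr p + ratr q * s = 0 -> p = 0 /\ q = 0.
Proof.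
move=> pq0; have [q0|q0] := eqVneq q 0.
  split=> //; move: pq0; rewrite q0 rmorph0 mul0r addr0 => /eqP.
  by rewrite fmorph_eq0 => /eqP.
have q0' : ratr q != 0 :> R by rewrite fmorph_eq0.
have sE : s = ratr (- p / q).
  rewrite rmorphM rmorphN fmorphV /=; apply: (mulfI q0').
  rewrite mulrCA divff // mulr1; lra.
have := sqr_sqrtN; rewrite sE -rmorphXn -(ratr_nat R N) => /fmorph_inj yN.
(* A rational whose square is an integer is an integer: the criterion with squarefree factor 1. *)
have [k kE] : exists k : int, - p / q = k%:~R.
  apply: (@rat_int_of_sqr 1 _ N%:Z squarefree1); rewrite mul1r yN.
  by rewrite -pmulrn.
move: yN; rewrite kE -rmorphXn /= (pmulrn _ N) => /intr_inj.
by move/(congr1 absz); rewrite abszX absz_nat => /esym /N_nonsquare.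
Qed.

Lemma sqrtN_irrational_int (a b : int) :
  a%:~R + b%:~R * s = 0 -> a = 0 /\ b = 0.
Proof.
rewrite -(ratr_int R a) -(ratr_int R b) => /sqrtN_irrational.
by move=> [/eqP + /eqP]; rewrite !intr_eq0 => /eqP -> /eqP ->.
Qed.

(** Evaluation of integer polynomials commutes with s -> -s; hence the conjugate of an integral
    element is integral. *)
Lemma horner_conjugate (p q : rat) (f : {poly int}) :
  exists F G : rat,
    (map_poly intr f).[ratr p + ratr q * s] = ratr F + ratr G * s /\
    (map_poly intr f).[ratr p - ratr q * s] = ratr F - ratr G * s.
Proof.
elim/poly_ind: f => [|f c [F [G [IH1 IH2]]]].
  by exists 0, 0; rewrite rmorph0 !horner0 !rmorph0 mul0r subr0 addr0.
exists (F * p + N%:R * G * q + c%:~R), (F * q + G * p).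
rewrite rmorphD rmorphM /= map_polyX map_polyC /=.
rewrite !(hornerD, hornerM, hornerX, hornerC) IH1 IH2.
by rewrite !(rmorphD, rmorphM) /= ratr_int ratr_nat -sqr_sqrtN; split; ring.
Qed.

(** Trace and norm of x are rational and integral, hence integers. Then N (2q)^2 is an integer too,
    and squarefreeness of N makes 2q one, without distinguishing N modulo 4. *)
Lemma ring_of_integers_halves (x : R) :
  ring_of_integers N x ->
  exists a b n : int, 2 * x = a%:~R + b%:~R * s /\ a ^+ 2 - N%:Z * b ^+ 2 = 4 * n.
Proof.
move=> [[p [q ->]] ix].
have ic : integralOver (intr : int -> R) (ratr p - ratr q * s).
  case: ix => f mf rf; exists f => //.
  have [F [G [E1 E2]]] := horner_conjugate p q f.
  move: rf; rewrite /root E1 E2 => /eqP/sqrtN_irrational[-> ->].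
  by rewrite !rmorph0 mul0r subr0.
have [a aE] : exists a : int, 2 * p = a%:~R.
  apply: (@integral_rat_int R); have := integral_add ix ic.
  by congr integralOver; rewrite rmorphM /= ratr_nat; ring.
have [n nE] : exists n : int, p ^+ 2 - N%:R * q ^+ 2 = n%:~R.
  apply: (@integral_rat_int R); have := integral_mul ix ic.
  congr integralOver; rewrite rmorphB !(rmorphXn, rmorphM) /= ratr_nat.
  by rewrite -sqr_sqrtN; ring.
have [b bE] : exists b : int, 2 * q = b%:~R.
  apply: (@rat_int_of_sqr N _ (a ^+ 2 - 4 * n)) => //.
  by rewrite rmorphB !(rmorphXn, rmorphM) /= -nE -aE; ring.
exists a, b, n; split.
  by rewrite -(ratr_int R a) -(ratr_int R b) -aE -bE !rmorphM /= !ratr_nat; ring.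
apply: (@intr_inj rat); rewrite rmorphB !(rmorphXn, rmorphM) /= -aE -bE -nE.
by ring.
Qed.

Lemma ring_of_integersM (x y : R) :
  ring_of_integers N x -> ring_of_integers N y ->
  ring_of_integers N (x * y).
Proof.
move=> [[p [q xE]] ix] [[p' [q' yE]] iy]; split; last exact: integral_mul.
exists (p * p' + N%:R * q * q'), (p * q' + q * p').
by rewrite xE yE !rmorphD !rmorphM /= ratr_nat -sqr_sqrtN; ring.
Qed.

Lemma ring_of_integers_order (a b : int) :
  ring_of_integers N (a%:~R + b%:~R * s).
Proof.
split; first by exists a%:~R, b%:~R; rewrite !ratr_int.
apply: integral_add; first exact: integral_id.
apply: integral_mul; first exact: integral_id.
exists ('X^2 - N%:Z%:P).
  rewrite monicE lead_coefDl ?lead_coefXn //.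
  by rewrite size_polyN size_polyXn size_polyC; case: eqP.
rewrite rmorphB /= map_polyXn map_polyC /= /root !hornerE.
by rewrite sqr_sqrtN -pmulrn subrr.
Qed.

Lemma integer_unitsM (x y : R) :
  integer_units N x -> integer_units N y -> integer_units N (x * y).
Proof.
move=> [ix [x' ix' xx']] [iy [y' iy' yy']]; split; first exact: ring_of_integersM.
by exists (x' * y'); [exact: ring_of_integersM | rewrite mulrACA xx' yy' mulr1].
Qed.

Lemma integer_units1 : integer_units N (1 : R).
Proof.
have i1 : ring_of_integers N (1 : R).
  by have := ring_of_integers_order 1 0; rewrite mul0r addr0.
by split=> //; exists 1 => //; rewrite mulr1.
Qed.

Lemma integer_unitsN (x : R) : integer_units N x -> integer_units N (- x).
Proof.
have i1 : ring_of_integers N (-1 : R).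
  by have := ring_of_integers_order (-1) 0; rewrite mul0r addr0.
rewrite -mulN1r; apply: integer_unitsM.
by split=> //; exists (-1) => //; rewrite mulrNN mulr1.
Qed.

Lemma integer_units_neq0 (x : R) : integer_units N x -> x != 0.
Proof.
by move=> [_ [y _ /eqP]]; apply: contraL => /eqP ->; rewrite mul0r eq_sym oner_eq0.
Qed.

Lemma integer_unitsV (x : R) : integer_units N x -> integer_units N x^-1.
Proof.
move=> ux; have x0 := integer_units_neq0 _ ux; case: ux => ix [y iy xy].
have -> : x^-1 = y by rewrite -[LHS]mulr1 -xy mulKf.
by split=> //; exists x => //; rewrite mulrC.
Qed.

Lemma integer_unitsX (x : R) (n : nat) :
  integer_units N x -> integer_units N (x ^+ n).
Proof.
move=> ux; elim: n => [|n IH]; first exact: integer_units1.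
by rewrite exprS; apply: integer_unitsM.
Qed.

(** * Units of the order Z[s] and their relation to all integer units *)

Definition order_unit (u : R) : Prop :=
  exists a b : int,
    u = a%:~R + b%:~R * s /\ (a ^+ 2 - N%:Z * b ^+ 2) ^+ 2 = 1.

Lemma order_unitM (u v : R) : order_unit u -> order_unit v -> order_unit (u * v).
Proof.
move=> [a [b [-> ab]]] [c [d [-> cd]]].
exists (a * c + N%:Z * b * d), (a * d + b * c); split.
  by rewrite !rmorphD !rmorphM /= -pmulrn -sqr_sqrtN; ring.
rewrite -[RHS]mul1r -{1}ab -cd; ring.
Qed.

(** Since the norm n satisfies n^2 = 1, the inverse is n times the conjugate. *)
Lemma order_unitV (u : R) : order_unit u -> order_unit u^-1.
Proof.
move=> [a [b [-> ab]]]; set n := a ^+ 2 - N%:Z * b ^+ 2 in ab.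
have E : (a%:~R + b%:~R * s) * ((n * a)%:~R + (n * - b)%:~R * s) = 1 :> R.
  transitivity ((n ^+ 2)%:~R : R); last by rewrite ab.
  rewrite expr2 {3}/n !(rmorphXn, rmorphM, rmorphB, rmorphN) /= -pmulrn -sqr_sqrtN.
  ring.
have u0 : a%:~R + b%:~R * s != 0 :> R.
  by apply/eqP => u0; move/eqP: E; rewrite u0 mul0r eq_sym oner_eq0.
exists (n * a), (n * - b); split; first by apply: (mulfI u0); rewrite divff ?E.
have -> : (n * a) ^+ 2 - N%:Z * (n * - b) ^+ 2 = n ^+ 2 * n by rewrite /n; ring.
by rewrite ab mul1r.
Qed.

Lemma order_unit_integer_units (u : R) : order_unit u -> integer_units N u.
Proof.
move=> ou; have [a [b [uV _]]] := order_unitV _ ou.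
case: ou => c [d [uE nE]].
have iu : ring_of_integers N u by rewrite uE; exact: ring_of_integers_order.
have iv : ring_of_integers N u^-1 by rewrite uV; exact: ring_of_integers_order.
split=> //; exists u^-1 => //; apply: divff; apply/eqP => u0.
move: nE; rewrite uE in u0; case: (sqrtN_irrational_int _ _ u0) => -> ->.
by rewrite expr0n mulr0 subrr expr0n.
Qed.

(** Comparing coefficients in (2u)(2v) = 4 and taking norms gives (4n)(4m) = 16, so n is a unit of
    the integers. *)
Lemma integer_units_halves (u : R) :
  integer_units N u ->
  exists a b n : int, [/\ 2 * u = a%:~R + b%:~R * s,
    a ^+ 2 - N%:Z * b ^+ 2 = 4 * n & n = 1 \/ n = -1].
Proof.
move=> [/ring_of_integers_halves [a [b [n [uE nE]]]] [v]].
move=> /ring_of_integers_halves [c [d [m [vE mE]]]] uv.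
exists a, b, n; split=> //; apply: (@intz_mul_eq1 _ m).
have /sqrtN_irrational_int[E1 E2] :
    (a * c + N%:Z * b * d - 4)%:~R + (a * d + b * c)%:~R * s = 0.
  have : (2 * u) * (2 * v) = 4 by rewrite mulrACA uv; ring.
  rewrite uE vE !(rmorphM, rmorphD, rmorphB) /= -pmulrn -sqr_sqrtN => E.
  by rewrite -[RHS](subrr (4 : R)) -{1}E; ring.
have : (4 * n) * (4 * m) = 16.
  rewrite -nE -mE; transitivity
    ((a * c + N%:Z * b * d - 4 + 4) ^+ 2 - N%:Z * (a * d + b * c) ^+ 2).
    by ring.
  by rewrite E1 E2 add0r expr0n mulr0 subr0.
lia.
Qed.

(* For a unit (a + b s)/2 of norm n with a and b odd, a^2 - N b^2 = 4 n gives
   ((a + b s)/2)^3 = a (a^2 - 3 n)/2 + b (a^2 - n)/2 s, where both quotients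
   are integers. *)
Lemma integer_units_order (u : R) :
  integer_units N u -> order_unit u \/ order_unit (u ^+ 3).
Proof.
move=> /integer_units_halves [a [b [n [uE nE n1]]]].
have nn : n ^+ 2 = 1 by case: n1 => ->.
have parity (z : int) : exists w : int, z = 2 * w \/ z = 2 * w + 1.
  by exists (z %/ 2)%Z; lia.
have [w nw] : exists w : int, n = 2 * w + 1 by case: n1 => ->; [exists 0 | exists (-1)].
have [a' [aE|aE]] := parity a; have [b' [bE|bE]] := parity b.
- left; exists a', b'; split; last first.
    by rewrite -[RHS]nn; congr (_ ^+ 2); move: nE; rewrite aE bE; nia.
  by move: uE; rewrite aE bE !rmorphM /=; lra.
(* With a even and b odd, 4 divides N b^2 and b^2 is 1 modulo 4, so 4 would divide N. *)
- have : (2 ^ 2 %| N)%N.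
    have -> : N = `|(4 * (a' ^+ 2 - n - N%:Z * (b' ^+ 2 + b')))%R|%N.
      by move: nE; rewrite aE bE; nia.
    by rewrite abszM dvdn_mulr.
  by move/N_squarefree.
- by exfalso; move: nE; rewrite aE bE; nia.
(* [X] and [Y] are (a^2 - 3n)/2 and (a^2 - n)/2 with a = 2a' + 1 and n = 2w + 1 substituted. *)
- right; pose X := 2 * a' ^+ 2 + 2 * a' - 3 * w - 1.
  pose Y := 2 * a' ^+ 2 + 2 * a' - w; exists (a * X), (b * Y).
  have NE : N%:Z * b ^+ 2 = a ^+ 2 - 4 * n by rewrite -nE; ring.
  split; last first.
    have E : N%:Z * (b * Y) ^+ 2 = (a ^+ 2 - 4 * n) * Y ^+ 2 by rewrite -NE; ring.
    have -> : (a * X) ^+ 2 - N%:Z * (b * Y) ^+ 2 = n ^+ 2 * n.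
      by rewrite E aE nw /X /Y; ring.
    by rewrite nn mul1r.
  apply: (@mulfI _ (8 : R)); first by rewrite pnatr_eq0.
  have -> : 8 * u ^+ 3 = (2 * u) ^+ 3 by ring.
  rewrite uE; transitivity ((a * (a ^+ 2 + 3 * (N%:Z * b ^+ 2)))%:~R
      + (b * (3 * a ^+ 2 + N%:Z * b ^+ 2))%:~R * s : R).
    by rewrite !(rmorphXn, rmorphM, rmorphD) /= -!pmulrn -sqr_sqrtN; ring.
  rewrite NE nw /X /Y !(rmorphXn, rmorphM, rmorphD, rmorphB) /=.
  by rewrite aE !(rmorphM, rmorphD) /=; ring.
Qed.

(** * Existence of the fundamental unit *)

(** The conjugate u' has |u'| < 1 < u, so a = u + u' and b s = u - u' are positive; the integers a
    and b are then at least 1. *)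
Lemma integer_units_lower_bound (u : R) :
  integer_units N u -> 1 < u -> (1 + s) / 2 <= u.
Proof.
move=> /integer_units_halves [a [b [n [uE nE n1]]]] u1.
set w : R := a%:~R - b%:~R * s.
have uw : u * w = 2 * n%:~R.
  have : (2 * u) * w = (4 * n)%:~R.
    rewrite uE /w -nE !(rmorphXn, rmorphB, rmorphM) /= -pmulrn -sqr_sqrtN; ring.
  rewrite rmorphM /=; lra.
have s1 := sqrtN_gt1.
have w2 : `|w| < 2.
  have : u * `|w| = 2.
    have <- : `|u * w| = 2 :> R.
      rewrite uw normrM; case: n1 => ->;
        by rewrite ?rmorphN /= ?normrN normr1 normr_nat mulr1.
    by rewrite normrM (gtr0_norm (lt_trans ltr01 u1)).
  have [//|w2] := ltP `|w| 2; nra.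
move: w2; rewrite ltr_norml => /andP[wl wr].
have a1 : 1 <= a.
  rewrite -gtz0_ge1 -(ltr0z R); rewrite /w in wl wr; lra.
have b1 : 1 <= b.
  rewrite -gtz0_ge1 -(ltr0z R); rewrite /w in wl wr; nra.
have {}a1 : 1 <= a%:~R :> R by rewrite -(ler_int R) in a1.
have {}b1 : 1 <= b%:~R :> R by rewrite -(ler_int R) in b1.
nra.
Qed.

(* Descent: if v < u are units above 1, then u / v is bounded below too, so v
   is smaller than u by the fixed factor (1 + s) / 2. *)
Lemma minimal_unit_exists (u : R) :
  integer_units N u -> 1 < u ->
  exists e : R, [/\ integer_units N e, 1 < e &
    forall v : R, integer_units N v -> 1 < v -> e <= v].
Proof.
set c : R := (1 + s) / 2; have c1 : 1 < c by have := sqrtN_gt1; rewrite /c; lra.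
have [m] : exists m, u < c ^+ m.
  pose m := Num.bound (`|u| / (c - 1)); exists m.
  have c0 : 0 < c - 1 by lra.
  have := @archi_boundP R (`|u| / (c - 1)) (divr_ge0 (normr_ge0 _) (ltW c0)).
  rewrite -/m ltr_pdivrMr // => h.
  (* Bernoulli's inequality makes the powers of [c] exceed u; the exponent [m] then drives the
     descent. *)
  have B (k : nat) : 1 + k%:R * (c - 1) <= c ^+ k.
    elim: k => [|k IH]; first by rewrite mul0r addr0.
    rewrite exprS; apply: le_trans (ler_wpM2l (ltW (lt_trans ltr01 c1)) IH).
    by have := mulr_ge0 (ler0n R k) (sqr_ge0 (c - 1)); rewrite -natr1; nra.
  have := B m; have := ler_norm u; lra.
elim: m u => [|m IH] u um uu u1; first by move: um; rewrite expr0; lra.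
have [umin|] := pselect (forall v, integer_units N v -> 1 < v -> u <= v).
  by exists u.
move=> /existsNP[v /not_implyP[uv /not_implyP[v1 /negP]]]; rewrite -ltNge => vu.
have v0 : 0 < v by lra.
apply: (IH v) => //.
have q1 : 1 < u / v by rewrite ltr_pdivlMr // mul1r.
have := integer_units_lower_bound _ (integer_unitsM _ _ uu (integer_unitsV _ uv)) q1.
rewrite -/c ler_pdivlMr // => cv.
rewrite -(ltr_pM2l (lt_trans ltr01 c1)) -exprS; exact: le_lt_trans cv um.
Qed.

(** Let e be the least unit above 1. A unit w >= 1 lies in some [e^k, e^(k+1)), and w / e^k is a
    unit in [1, e), hence 1. Inversion and negation reach the remaining units. *)
Lemma fundamental_unit_exists (u : R) :
  integer_units N u -> 1 < u -> exists e : R, is_fundamental_unit N e.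
Proof.
move=> uu u1; have [e [ue e1 emin]] := minimal_unit_exists _ uu u1.
exists e; split=> // v uv.
have e0 : 0 < e by lra.
have ge1 (w : R) : integer_units N w -> 1 <= w -> exists k : nat, w = e ^+ k.
  move=> uw w1; have w0 : 0 < w by lra.
  have le0 : 0 < ln e by rewrite ln_gt0.
  have q0 : 0 <= ln w / ln e by rewrite divr_ge0 ?ln_ge0 // ltW.
  exists (Num.trunc (ln w / ln e)); set k := Num.trunc _.
  have /andP[kl kr] := truncn_itv q0; rewrite -/k in kl kr.
  rewrite ler_pdivlMr // in kl; rewrite ltr_pdivrMr // in kr.
  have ek0 : 0 < e ^+ k by rewrite exprn_gt0.
  have lw : e ^+ k <= w by rewrite -ler_ln ?posrE // lnXn // -mulr_natl.
  have wl : w < e ^+ k.+1.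
    by rewrite -ltr_ln ?posrE ?exprn_gt0 // lnXn // -mulr_natl.
  apply/eqP; rewrite eq_le lw andbT leNgt; apply/negP => lw'.
  have := emin (w / e ^+ k); rewrite ler_pdivlMr // -exprS ltr_pdivlMr // mul1r.
  move=> /(_ (integer_unitsM _ _ uw (integer_unitsV _ (integer_unitsX _ k ue))) lw').
  by rewrite leNgt wl.
have pos (w : R) : integer_units N w -> 0 < w -> exists k : int, w = e ^ k.
  move=> uw w0; have [w1|w1] := leP 1 w.
    by have [k ->] := ge1 w uw w1; exists k%:Z.
  have [|k kE] := ge1 w^-1 (integer_unitsV _ uw).
    by rewrite invf_ge1 // ltW.
  by exists (- k%:Z); rewrite -exprnN -kE invrK.
have v0 := integer_units_neq0 _ uv.
have [v_gt0|v_le0] := ltP 0 v.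
  by have [k kE] := pos v uv v_gt0; exists k; left.
have [|k kE] := pos (- v) (integer_unitsN _ uv).
  by rewrite oppr_gt0 lt_neqAle v0.
by exists k; right; rewrite -kE opprK.
Qed.

(* A power e^k in the order with minimal exponent k > 0 must have k = 1 or 3,
   since e or e^3 lies in the order. *)
Lemma minimal_order_unit_pow (b e : R) :
  order_unit b -> 1 < b -> (forall u, order_unit u -> 1 < u -> b <= u) ->
  is_fundamental_unit N e -> b = e \/ b = e ^+ 3.
Proof.
move=> ob b1 bmin [ue e1 efund].
have e0 : 0 < e by lra.
have [k bE] : exists k : nat, b = e ^+ k.
  have [k [kE|kE]] := efund b (order_unit_integer_units _ ob); last first.
    by have := exprz_gt0 k e0; move: b1; rewrite kE; lra.
  case: k kE => k kE; first by exists k.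
  exfalso; move: b1; rewrite kE NegzE -exprnN invf_gt1 ?exprn_gt0 //.
  by rewrite ltNge exprn_ege1 // ltW.
have k_le (m : nat) : (0 < m)%N -> order_unit (e ^+ m) -> (k <= m)%N.
  move=> m0 om; rewrite -(ler_eXn2l e1) -bE bmin // exprn_egt1 -?lt0n //.
have k0 : k != 0%N by apply/eqP => k0; move: b1; rewrite bE k0 expr0; lra.
case: (integer_units_order _ ue) => oe.
  have := k_le 1%N isT; rewrite expr1 => /(_ oe) k1; left.
  by rewrite bE (_ : k = 1%N) ?expr1 //; lia.
have := k_le 3 isT oe => k3.
have [k1|[k2|k3']] : k = 1%N \/ k = 2%N \/ k = 3%N by lia.
- by left; rewrite bE k1 expr1.
(* Exponent 2 is impossible: e = e^3 / e^2 would lie in the order, contradicting minimality of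
   [k]. *)
- left; have oe1 : order_unit e.
    rewrite (_ : e = e ^+ 3 * (e ^+ 2)^-1).
      by apply: order_unitM => //; apply: order_unitV; rewrite -k2 -bE.
    by rewrite exprS mulfK // expf_neq0 // gt_eqF.
  have := k_le 1%N isT; rewrite expr1 => /(_ oe1); lia.
- by right; rewrite bE k3'.
Qed.

End QuadraticOrder.

(** * Partial quotients determine the number *)

Section PartialQuotients.
Variable R : realType.
Implicit Types x y : R.

Lemma complete_quotientD x m n :
  complete_quotient x (m + n) = complete_quotient (complete_quotient x n) m.
Proof. by elim: m => //= m ->. Qed.

Lemma complete_quotientE x m :
  complete_quotient x m =
    (partial_quotient x m)%:~R + (complete_quotient x m.+1)^-1.
Proof. by rewrite /= invrK addrC subrK. Qed.

Lemma partial_quotient_ge1 x m :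
  1 < complete_quotient x m -> 1 <= partial_quotient x m.
Proof.
move=> x1; have /andP[_] := floor_itv (complete_quotient x m).
move=> /(lt_trans x1); rewrite -[1 in X in X -> _]/(1%:~R) ltr_int.
by rewrite ltzD1.
Qed.

(* The two complete quotients after two steps differ by x - y times
   x_1 x_2 y_1 y_2 >= 4, but two numbers with equal floors differ by less
   than 1. *)
Lemma partial_quotients_inj x y :
  (forall m, 1 < complete_quotient x m.+1) ->
  (forall m, 1 < complete_quotient y m.+1) ->
  (forall m, partial_quotient x m = partial_quotient y m) -> x = y.
Proof.
move=> x1 y1 xy.
have bound n : `|x - y| * 2 ^+ n <= 1.
  elim: n x y x1 y1 xy => [|n IH] x y x1 y1 xy.
    rewrite expr0 mulr1 ltW // ltr_norml.
    have /andP[] := floor_itv x; have /andP[] := floor_itv y.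
    have := xy 0%N; rewrite /partial_quotient /= => ->.
    rewrite rmorphD /=; lra.
  set x' := complete_quotient x 2%N; set y' := complete_quotient y 2%N.
  have := IH x' y'.
  have sh (z : R) m :
      complete_quotient (complete_quotient z 2%N) m = complete_quotient z m.+2.
    by rewrite -complete_quotientD addn2.
  rewrite /partial_quotient /x' /y' => /(_ _ _ _)/wrap[].
  - by move=> m; rewrite sh.
  - by move=> m; rewrite sh.
  - by move=> m; rewrite !sh; exact: xy.
  rewrite -/x' -/y' => {}IH.
  apply: le_trans IH; rewrite exprS mulrA ler_pM2r ?exprn_gt0 //.
  have x0E := complete_quotientE x 0; have y0E := complete_quotientE y 0.
  have x1E := complete_quotientE x 1; have y1E := complete_quotientE y 1.
  have x11 := x1 0%N; have y11 := y1 0%N.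
  have x21 := x1 1%N; have y21 := y1 1%N.
  have ax := partial_quotient_ge1 _ _ x11; have ay := partial_quotient_ge1 _ _ y11.
  have e0 := xy 0%N; have e1 := xy 1%N.
  rewrite -/x' -/y' in x1E y1E x21 y21.
  move: x0E y0E x1E y1E x11 y11 ax ay; rewrite e0 e1 [complete_quotient x 0]/=.
  rewrite [complete_quotient y 0]/=.
  set x1' := complete_quotient x 1; set y1' := complete_quotient y 1.
  set a0 := partial_quotient y 0; set a1 := partial_quotient y 1.
  move=> x0E y0E x1E y1E x11 y11 _; rewrite -(ler_int R) => a1_ge1.
  have x10 : x1' != 0 by rewrite gt_eqF // (lt_trans ltr01).
  have y10 : y1' != 0 by rewrite gt_eqF // (lt_trans ltr01).
  have x20 : x' != 0 by rewrite gt_eqF // (lt_trans ltr01).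
  have y20 : y' != 0 by rewrite gt_eqF // (lt_trans ltr01).
  (* Since x_1 = a_1 + 1/x_2, the product is a_1 x_2 + 1. *)
  have xx : 2 <= x1' * x'.
    rewrite x1E mulrDl mulVf //.
    by have : 1 <= a1%:~R :> R by []; nra.
  have yy : 2 <= y1' * y'.
    rewrite y1E mulrDl mulVf //.
    by have : 1 <= a1%:~R :> R by []; nra.
  have -> : x' - y' = (x - y) * (x1' * x' * (y1' * y')).
    have -> : x - y = x1'^-1 - y1'^-1 by rewrite x0E y0E; ring.
    have -> : (x1'^-1 - y1'^-1) * (x1' * x' * (y1' * y')) = (y1' - x1') * (x' * y').
      by field; rewrite x10 y10.
    by rewrite x1E y1E; field; rewrite x20 y20.
  rewrite normrM; apply: ler_wpM2l => //.
  have /ger0_norm -> : 0 <= x1' * x' * (y1' * y') by nra.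
  nra.
(* A nonzero distance d would violate the bound once n > 1/d, because 2^n > n. *)
apply/eqP; rewrite -subr_eq0 -normr_eq0 eq_le normr_ge0 andbT leNgt.
apply/negP => d0; set d := `|x - y| in d0 bound.
have := @archi_boundP R d^-1 (ltW _); rewrite invr_gt0 => /(_ d0).
set n := Num.bound _; rewrite -(ltr_pM2l d0) divff ?gt_eqF // => dn.
have := bound n; rewrite leNgt => /negP; apply; apply: lt_le_trans dn _.
by rewrite ler_pM2l // -natrX ler_nat ltnW // ltn_expl.
Qed.

End PartialQuotients.

(** * Convergents of sqrt N and their conjugates *)

Lemma conv_numSS (a : nat -> int) m :
  conv_num a m.+2 = a m.+1 * conv_num a m.+1 + conv_num a m.
Proof. by []. Qed.

Lemma conv_denSS (a : nat -> int) m :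
  conv_den a m.+2 = a m.+1 * conv_den a m.+1 + conv_den a m.
Proof. by []. Qed.

Lemma conv_det (a : nat -> int) m :
  conv_num a m.+1 * conv_den a m - conv_den a m.+1 * conv_num a m = (-1) ^+ m.+1.
Proof.
elim: m => [|m IH]; first by rewrite /= mulr0 sub0r mulr1 expr1.
by rewrite conv_numSS conv_denSS exprS -IH; ring.
Qed.

Section SqrtConvergents.
Variables (R : realType) (N : nat).
Hypothesis N_nonsquare : forall k : nat, N <> (k ^ 2)%N.

Local Notation s := (sqrtN R N).
Local Notation a := (a_ R N).
Local Notation p := (conv_num a).
Local Notation q := (conv_den a).
Local Notation c := (complete_quotient s).

Definition conv_plus (m : nat) : R := (p m)%:~R + (q m)%:~R * s.
Definition conv_minus (m : nat) : R := (p m)%:~R - (q m)%:~R * s.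
Local Notation beta := conv_plus.
Local Notation alpha := conv_minus.

Lemma conv_plusSS m : beta m.+2 = (a m.+1)%:~R * beta m.+1 + beta m.
Proof.
by rewrite /conv_plus conv_numSS conv_denSS !(rmorphD, rmorphM) /=; ring.
Qed.

Lemma conv_minusSS m : alpha m.+2 = (a m.+1)%:~R * alpha m.+1 + alpha m.
Proof.
by rewrite /conv_minus conv_numSS conv_denSS !(rmorphD, rmorphM) /=; ring.
Qed.

Lemma conv_minus_neq0 m : alpha m != 0.
Proof.
apply/eqP => a0; have : (p m)%:~R + (- q m)%:~R * s = 0.
  by rewrite rmorphN /= mulNr.
move=> /(sqrtN_irrational_int _ _ N_nonsquare)[p0 /eqP].
rewrite oppr_eq0 => /eqP q0; have /eqP := conv_det a m.
by rewrite p0 q0 !mulr0 subrr eq_sym signr_eq0.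
Qed.

Lemma complete_quotient_frac m : c m - (a m)%:~R = - alpha m.+1 / alpha m.
Proof.
elim: m => [|m IH]; first by rewrite /conv_minus /= mul0r subr0 divr1 mul1r opprB.
have -> : c m.+1 = - alpha m / alpha m.+1.
  have -> : c m.+1 = (c m - (a m)%:~R)^-1 by [].
  by rewrite IH invf_div invrN mulrN mulNr.
rewrite conv_minusSS; field; exact: conv_minus_neq0.
Qed.

Lemma complete_quotientS m : c m.+1 = - alpha m / alpha m.+1.
Proof.
have -> : c m.+1 = (c m - (a m)%:~R)^-1 by [].
by rewrite complete_quotient_frac invf_div invrN mulrN mulNr.
Qed.

(** Irrationality of s keeps [conv_minus] away from 0, so no fractional part vanishes and each next
    complete quotient inverts a number strictly between 0 and 1. *)
Lemma complete_quotient_gt1 m : 1 < c m.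
Proof.
case: m => [|m]; first exact: sqrtN_gt1.
have /andP[] := floor_itv (c m).
rewrite -/(partial_quotient s m) -/(a m) rmorphD /= => h1 h2.
have f0 : c m - (a m)%:~R != 0.
  by rewrite complete_quotient_frac mulf_neq0 ?oppr_eq0 ?invr_eq0 ?conv_minus_neq0.
rewrite -[X in 1 < X]/((c m - (a m)%:~R)^-1) invf_gt1; first by lra.
by rewrite lt_def f0 /=; lra.
Qed.

Lemma partial_quotient_sqrtN_ge1 m : 1 <= (a m)%:~R :> R.
Proof.
rewrite -[X in X <= _]/(1%:~R) ler_int.
exact/partial_quotient_ge1/complete_quotient_gt1.
Qed.

Lemma conv_plus_ge1_lt m : 1 <= beta m /\ beta m < beta m.+1.
Proof.
elim: m => [|m [IH1 IH2]].
  rewrite /conv_plus /= mul0r addr0 mul1r.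
  have := partial_quotient_sqrtN_ge1 0; have := sqrtN_gt1 R N N_nonsquare.
  by split; [|lra].
have am := partial_quotient_sqrtN_ge1 m.+1.
by split; [lra | rewrite conv_plusSS; nra].
Qed.

Lemma conv_plus_gt0 m : 0 < beta m.
Proof. by have [] := conv_plus_ge1_lt m; lra. Qed.

(** The ratio -alpha_m / alpha_(m+1) is a complete quotient, hence positive, so the sign alternates
    from alpha_0 = 1. *)
Lemma conv_minus_sign m : 0 < (-1) ^+ m * alpha m.
Proof.
elim: m => [|m IH]; first by rewrite /conv_minus /= mul0r subr0 mul1r.
have c1 := complete_quotient_gt1 m.+1.
have -> : (-1) ^+ m.+1 * alpha m.+1 = (-1) ^+ m * alpha m / c m.+1.
  rewrite complete_quotientS exprS; field.
  by rewrite ?oppr_eq0 !conv_minus_neq0.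
by rewrite divr_gt0 //; lra.
Qed.

Lemma conv_minus_plus m :
  alpha m * beta m = (p m ^+ 2 - N%:Z * q m ^+ 2)%:~R.
Proof.
rewrite rmorphB !(rmorphXn, rmorphM) /= -pmulrn -(sqr_sqrtN R N).
by rewrite /conv_minus /conv_plus; ring.
Qed.

(** In the expanded product the rational part is [Omega] and the coefficient of s is the determinant
    of consecutive convergents. *)
Lemma conv_minus_plusS m :
  alpha m * beta m.+1 = (Omega R N m)%:~R + (-1) ^+ m * s.
Proof.
have := congr1 (intr : int -> R) (conv_det a m).
rewrite rmorphB !rmorphM rmorphXn rmorphN1 /= => det.
have -> : (-1) ^+ m = - ((-1) ^+ m.+1) :> R by rewrite exprS mulN1r opprK.
rewrite -det /Omega rmorphB !rmorphM /= -pmulrn -(sqr_sqrtN R N).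
by rewrite /conv_minus /conv_plus; ring.
Qed.

Lemma conv_minusS_plus m :
  alpha m.+1 * beta m = (Omega R N m)%:~R - (-1) ^+ m * s.
Proof.
have := congr1 (intr : int -> R) (conv_det a m).
rewrite rmorphB !rmorphM rmorphXn rmorphN1 /= => det.
have -> : (-1) ^+ m = - ((-1) ^+ m.+1) :> R by rewrite exprS mulN1r opprK.
rewrite -det /Omega rmorphB !rmorphM /= -pmulrn -(sqr_sqrtN R N).
by rewrite /conv_minus /conv_plus; ring.
Qed.

(** * Telescoping of the sum of the d_j *)

Let L m : R := ln (beta m / ((-1) ^+ m * alpha m)).

Lemma d_telescope j : d_ R N j = 2^-1 * L j.+1 - 2^-1 * L j.
Proof.
rewrite -mulrBr /L -ln_div ?posrE ?divr_gt0 ?conv_plus_gt0 ?conv_minus_sign //.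
congr (_ * ln _); set e : R := (-1) ^+ j.
have ee : e * e = 1 by rewrite -expr2 sqrr_sign.
have -> : s + e * (Omega R N j)%:~R = e * (alpha j * beta j.+1).
  by rewrite conv_minus_plusS -/e mulrDr [e * (e * _)]mulrA ee mul1r addrC.
have -> : s - e * (Omega R N j)%:~R = - e * (alpha j.+1 * beta j).
  by rewrite conv_minusS_plus -/e mulNr mulrBr [e * (e * _)]mulrA ee mul1r opprB.
rewrite exprS -/e; field.
by rewrite ?oppr_eq0 !signr_eq0 !conv_minus_neq0 !gt_eqF ?conv_plus_gt0.
Qed.

Lemma sum_d (t : nat) :
  \sum_(0 <= j < t) d_ R N j = 2^-1 * ln (beta t / ((-1) ^+ t * alpha t)).
Proof.
under eq_bigr do rewrite d_telescope.
rewrite (telescope_sumr (fun j => 2^-1 * L j)) // /L.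
(* beta_0 = alpha_0 = 1, so the lower end of the telescope contributes ln 1 = 0. *)
rewrite /conv_plus /conv_minus /= !mul0r subr0 addr0 expr0 mul1r divr1.
by rewrite ln1 mulr0 subr0.
Qed.

(** * Periods and convergents of norm 1 or -1 *)

Lemma complete_quotient_period (t : nat) :
  is_period a t -> c t.+1 = c 1.
Proof.
move=> [t0 per]; apply: partial_quotients_inj => m.
- by rewrite -complete_quotientD complete_quotient_gt1.
- by rewrite -complete_quotientD complete_quotient_gt1.
- rewrite /partial_quotient -!complete_quotientD.
  have := per m.+1 isT; rewrite /a_ /partial_quotient.
  by rewrite addn1 addnS addSn.
Qed.

(** Here c_t = a_0 + s, so (s + a_0) alpha_t + alpha_(t-1) = 0. Its two coefficients express the
    convergent at t-1 through the one at t; substituted in the determinant identity, they turn it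
    into the norm. *)
Lemma conv_norm_period (t : nat) :
  is_period a t -> a t = 2 * a 0 ->
  p t ^+ 2 - N%:Z * q t ^+ 2 = (-1) ^+ t.
Proof.
move=> per at0; have cS := complete_quotient_period t per.
have := complete_quotientE _ s t; rewrite cS -/(a t) at0.
have -> : (c 1)^-1 = s - (a 0)%:~R by rewrite /= invrK.
case: t per at0 cS => [[]//|t] _ _ _.
have det := conv_det a t; have := conv_minus_neq0 t.+1.
rewrite complete_quotientS /conv_minus.
move: (p t.+1) (q t.+1) (p t) (q t) det => P Q P' Q' det PQ0.
rewrite rmorphM /= => ct.
have /(sqrtN_irrational_int _ _ N_nonsquare)[E1 E2] :
    (a 0 * P - N%:Z * Q + P')%:~R + (P - a 0 * Q - Q')%:~R * s = 0.
  have : (s + (a 0)%:~R) * (P%:~R - Q%:~R * s) + (P'%:~R - Q'%:~R * s) = 0.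
    have -> : s + (a 0)%:~R = 2 * (a 0)%:~R + (s - (a 0)%:~R) by ring.
    by rewrite -ct divfK // addNr.
  rewrite !(rmorphD, rmorphN, rmorphM) /= -pmulrn -(sqr_sqrtN R N) => <-.
  by ring.
rewrite -det.
have -> : P' = - (a 0 * P - N%:Z * Q) by lia.
have -> : Q' = P - a 0 * Q by lia.
by ring.
Qed.

Lemma conv_norm_sign (n : nat) :
  (p n ^+ 2 - N%:Z * q n ^+ 2) ^+ 2 = 1 ->
  p n ^+ 2 - N%:Z * q n ^+ 2 = (-1) ^+ n.
Proof.
set nu := (X in X ^+ 2 = _) => /eqP; rewrite sqrf_eq1 => nu1.
have : 0 < (-1) ^+ n * nu.
  rewrite -(ltr0z R) rmorphM rmorphXn rmorphN1 /= -conv_minus_plus mulrA.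
  by rewrite mulr_gt0 ?conv_minus_sign ?conv_plus_gt0.
by rewrite -/nu -signr_odd; case: (odd n); case/orP: nu1 => /eqP ->.
Qed.

(** Norm 1 or -1 clears the denominator of c_n = -alpha_(n-1) beta_n / (alpha_n beta_n), so c_n
    differs from s by an integer; both have the same fractional part and c_(n+1) = c_1. *)
Lemma is_period_conv_norm (n : nat) :
  (0 < n)%N -> (p n ^+ 2 - N%:Z * q n ^+ 2) ^+ 2 = 1 -> is_period a n.
Proof.
move=> n0 /conv_norm_sign nu.
have [k cn] : exists k : int, c n = k%:~R + s.
  case: n n0 nu => // n _ nu; exists ((-1) ^+ n * Omega R N n).
  have ab : alpha n.+1 * beta n.+1 = (-1) ^+ n.+1.
    by rewrite conv_minus_plus nu rmorphXn rmorphN1.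
  have -> : c n.+1 = - (alpha n * beta n.+1) / (alpha n.+1 * beta n.+1).
    rewrite complete_quotientS; field.
    by rewrite conv_minus_neq0 gt_eqF ?conv_plus_gt0.
  rewrite ab conv_minus_plusS rmorphM rmorphXn rmorphN1 /= exprS.
  by rewrite -signr_odd; case: (odd n) => /=; rewrite ?expr0 ?expr1; field.
have c1 : c n.+1 = c 1.
  by rewrite /= cn floorDzr ?intr_int // intrKfloor rmorphD /=; congr (_^-1); ring.
split=> // -[//|m] _; rewrite /a_ /partial_quotient.
by rewrite addSnnS complete_quotientD c1 -complete_quotientD addn1.
Qed.

(** * Units of Z[s] come from convergents *)

Lemma conv_plus_bracket (u : R) (m : nat) :
  1 < u -> u < beta m -> exists2 n, (n < m)%N & beta n <= u < beta n.+1.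
Proof.
move=> u1; elim: m => [|m IH] um.
  by move: um; rewrite /conv_plus /= mul0r addr0; lra.
have [/IH[n nm h]|h] := ltP u (beta m); first by exists n => //; exact: ltnW.
by exists m => //; rewrite h.
Qed.

(** The determinant is 1 or -1, so Cramer's rule has integer solutions. *)
Lemma conv_basis (n : nat) (A B : int) :
  exists x y : int, A = x * p n + y * p n.+1 /\ B = x * q n + y * q n.+1.
Proof.
have det := conv_det a n; set e : int := (-1) ^+ n.+1 in det.
have ee : e * e = 1 by rewrite -expr2 sqrr_sign.
exists (e * (B * p n.+1 - A * q n.+1)), (e * (A * q n - B * p n)).
by split; [rewrite -[A in LHS]mul1r | rewrite -[B in LHS]mul1r];
  rewrite -ee -{2}det; ring.
Qed.

(* A unit has |u u'| = 1, while |beta n * alpha n| >= 1. Hence, if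
   beta n < u < beta n.+1 then |u'| < |alpha n|, which is impossible in the
   basis beta n, beta n.+1 because alpha n and alpha n.+1 have opposite signs. *)
Lemma order_unit_conv (u : R) (m : nat) :
  order_unit R N u -> 1 < u -> u < beta m ->
  exists n, [/\ (0 < n)%N, (n < m)%N, u = beta n &
    (p n ^+ 2 - N%:Z * q n ^+ 2) ^+ 2 = 1].
Proof.
move=> [A [B [uE nAB]]] u1 um.
have [n nm /andP[bu ub]] := conv_plus_bracket u m u1 um.
suff ubn : u = beta n.
  exists n; split=> //.
    rewrite lt0n; apply/eqP => n0; move: u1.
    by rewrite ubn n0 /conv_plus /= mul0r addr0 ltxx.
  have /(sqrtN_irrational_int _ _ N_nonsquare)[/eqP + /eqP] :
      (A - p n)%:~R + (B - q n)%:~R * s = 0.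
    rewrite !rmorphB /= -(subrr u) {1}uE ubn /conv_plus; ring.
  by rewrite !subr_eq0 => /eqP <- /eqP <-.
apply/eqP; rewrite eq_le bu andbT leNgt; apply/negP => {}bu.
have [x [y [AE BE]]] := conv_basis n A B.
(* The conjugate of u, signed so that its expansion uses the positive numbers [al] and [al']. *)
set v : R := (-1) ^+ n * (A%:~R - B%:~R * s).
have uv : `|v| * u = 1.
  have -> : `|v| * u = `|(A ^+ 2 - N%:Z * B ^+ 2)%:~R|.
    rewrite /v normrM normr_sign mul1r.
    rewrite -[X in _ * X](gtr0_norm (lt_trans ltr01 u1)) -normrM uE; congr `|_|.
    by rewrite rmorphB !(rmorphXn, rmorphM) /= -pmulrn -(sqr_sqrtN R N); ring.
  move/eqP: nAB; rewrite sqrf_eq1 => /orP[] /eqP ->;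
    by rewrite ?rmorphN /= ?normrN normr1.
set al := (-1) ^+ n * alpha n; set al' := (-1) ^+ n.+1 * alpha n.+1.
have al0 : 0 < al := conv_minus_sign n; have al'0 : 0 < al' := conv_minus_sign n.+1.
have uxy : u = x%:~R * beta n + y%:~R * beta n.+1.
  by rewrite uE AE BE /conv_plus !(rmorphD, rmorphM) /=; ring.
have vxy : v = x%:~R * al - y%:~R * al'.
  by rewrite /v /al /al' AE BE /conv_minus exprS !(rmorphD, rmorphM) /=; ring.
have b0 := conv_plus_gt0 n; have b'0 := conv_plus_gt0 n.+1.
have ab1 : 1 <= al * beta n.
  have E : al * beta n = ((-1) ^+ n * (p n ^+ 2 - N%:Z * q n ^+ 2))%:~R.
    by rewrite /al -mulrA conv_minus_plus rmorphM rmorphXn rmorphN1.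
  have : 0 < al * beta n by rewrite mulr_gt0.
  by rewrite E ltr0z gtz0_ge1 -(ler_int R).
have val : `|v| < al.
  rewrite ltNge; apply/negP => h; have := normr_ge0 v; nra.
move: val; rewrite ltr_norml vxy => /andP[vl vr].
have int_ge1 (z : int) : 0 < z -> 1 <= z%:~R :> R.
  by rewrite gtz0_ge1 -(ler_int R).
have int_leN1 (z : int) : z < 0 -> z%:~R <= -1 :> R.
  by rewrite -oppr_gt0 => /int_ge1; rewrite rmorphN /=; lra.
(* If x, y <= 0 then u <= 0; if x >= 0 and y >= 1 then u >= beta_(n+1). For opposite signs, or y = 0
   with x nonzero, |v| >= [al]. Each case is a contradiction. *)
case: (ltgtP y 0) => [/int_leN1 y1|/int_ge1 y1|y0].
- by case: (ltgtP x 0) uxy => [/int_leN1 x1|/int_ge1 x1|->]; rewrite ?mul0r; nra.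
- by case: (ltgtP x 0) uxy => [/int_leN1 x1|/int_ge1 x1|->]; rewrite ?mul0r; nra.
- move: uxy vl vr; rewrite y0 !mul0r.
  by case: (ltgtP x 0) => [/int_leN1 x1|/int_ge1 x1|->]; rewrite ?mul0r; nra.
Qed.

Lemma conv_plus_le_order_unit (t : nat) (u : R) :
  is_minimal_period a t -> order_unit R N u -> 1 < u -> beta t <= u.
Proof.
move=> [_ tmin] ou u1; rewrite leNgt; apply/negP => ut.
have [n [n0 nt _ nu]] := order_unit_conv u t ou u1 ut.
by have := tmin n (is_period_conv_norm n n0 nu); rewrite leqNgt nt.
Qed.

Lemma sum_d_period (t : nat) :
  is_period a t -> a t = 2 * a 0 ->
  \sum_(0 <= j < t) d_ R N j = ln (beta t).
Proof.
move=> per at0; rewrite sum_d; have b0 := conv_plus_gt0 t.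
have -> : (-1) ^+ t * alpha t = (beta t)^-1.
  apply: (mulIf (lt0r_neq0 b0)); rewrite -mulrA conv_minus_plus conv_norm_period //.
  by rewrite rmorphXn rmorphN1 -expr2 sqrr_sign mulVf // gt_eqF.
rewrite invrK -expr2 lnXn // -mulr_natl; lra.
Qed.

End SqrtConvergents.

Theorem theorem6 (R : realType) (N tau : nat)
  (N_gt0 : (0 < N)%N)
  (N_squarefree : squarefree N)
  (N_nonsquare : forall k : nat, N <> (k ^ 2)%N)
  (tau_minimal : is_minimal_period (a_ R N) tau)
  (a_tau : a_ R N tau = 2 * a_ R N 0) :
  \sum_(0 <= j < tau) d_ R N j
    = ln ((conv_num (a_ R N) tau)%:~R + (conv_den (a_ R N) tau)%:~R * sqrtN R N)
  /\ (\sum_(0 <= j < tau) d_ R N j = regulator R N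
      \/ \sum_(0 <= j < tau) d_ R N j = 3 * regulator R N).
Proof.
have [tau_period _] := tau_minimal; have [tau_gt0 _] := tau_period.
rewrite -/(conv_plus R N tau) (sum_d_period R N N_nonsquare) //; split=> //.
set b := conv_plus R N tau.
have b_order : order_unit R N b.
  exists (conv_num (a_ R N) tau), (conv_den (a_ R N) tau); split=> //.
  by rewrite (conv_norm_period R N N_nonsquare) // sqrr_sign.
have b_gt1 : 1 < b.
  rewrite /b; case: tau tau_gt0 {tau_minimal a_tau tau_period b b_order} => // t _.
  by have [] := conv_plus_ge1_lt R N N_nonsquare t; apply: le_lt_trans.
have b_unit := order_unit_integer_units R N N_nonsquare b b_order.
(* The unit [b] > 1 guarantees that a fundamental unit exists, so [xget] does not return its
   default. *)
have fund : is_fundamental_unit N (fundamental_unit R N).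
  apply: xgetPex; exact: (fundamental_unit_exists R N N_squarefree N_nonsquare b).
have b_min u : order_unit R N u -> 1 < u -> b <= u.
  exact: conv_plus_le_order_unit.
have e_gt0 : 0 < fundamental_unit R N by case: fund => _ e1 _; lra.
have [->|->] := minimal_order_unit_pow R N N_squarefree N_nonsquare b _
  b_order b_gt1 b_min fund; [by left | right].
by rewrite lnXn // /regulator mulr_natl.
Qed.
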